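(* Let $U_7^{10}=\{L(C)\in TLeib_7 : c_{2,3}=0,\ c_{1,2}\neq 0,\ c_{1,1}=c_{0,1}=0,\ c_{0,0}\neq 0\}$. 1. Two algebras $L(C)$ and $L(C')$ from $U_7^{10}$ are isomorphic if and only if $$\frac{\left(4c'_{1,4}c'_{1,2}-5{c'}_{1,3}^{2}\right)^5}{{c'}_{1,2}^{12}{c'}_{0,0}^{2}}=\frac{\left(4c_{1,4}c_{1,2}-5c_{1,3}^2\right)^5}{c_{1,2}^{12}c_{0,0}^2}.$$ 2. For any $\lambda\in\mathbb{C}$ there exists $L(C)\in U_7^{10}$ with $\frac{(4c_{1,4}c_{1,2}-5c_{1,3}^2)^5}{c_{1,2}^{12}c_{0,0}^2}=\lambda$. Moreover, the orbits (isomorphism classes) in $U_7^{10}$ are parameterized by the algebras $L(1,0,0,1,0,\lambda,0)$, $\lambda\in\mathbb{C}$: these algebras lie in $U_7^{10}$ and every algebra in $U_7^{10}$ is isomorphic to one of them.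
   Context: All algebras are over $\mathbb{C}$. For $C=(c_{0,0},c_{0,1},c_{1,1},c_{1,2},c_{1,3},c_{1,4},c_{2,3})\in\mathbb{C}^7$, $L(C)$ denotes the $7$-dimensional complex (Leibniz) algebra with basis $e_0,e_1,\dots,e_6$ and products (products of basis vectors not listed are zero): $[e_i,e_0]=e_{i+1}$ for $1\le i\le 5$; $[e_0,e_i]=-e_{i+1}$ for $2\le i\le 5$; $[e_0,e_0]=c_{0,0}e_6$; $[e_0,e_1]=-e_2+c_{0,1}e_6$; $[e_1,e_1]=c_{1,1}e_6$; $[e_1,e_2]=-[e_2,e_1]=c_{1,2}e_4+c_{1,3}e_5+c_{1,4}e_6$; $[e_1,e_3]=-[e_3,e_1]=c_{1,2}e_5+c_{1,3}e_6$; $[e_1,e_4]=-[e_4,e_1]=(c_{1,2}-c_{2,3})e_6$; $[e_2,e_3]=-[e_3,e_2]=c_{2,3}e_6$. $TLeib_7$ is the set of all $L(C)$, $C\in\mathbb{C}^7$. The entries of $C'$ are denoted $c'_{i,j}$, in the same order. ''Isomorphic'' means isomorphic as algebras over $\mathbb{C}$; an orbit is an isomorphism class. *)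

(* Defs.v *)
From HB Require Import structures.
From mathcomp Require Import all_boot all_order all_algebra.
From mathcomp Require Import sesquilinear complex.
From mathcomp Require Import classical_sets reals.

Set Implicit Arguments.
Unset Strict Implicit.
Unset Printing Implicit Defensive.

Import GRing.Theory.
Local Open Scope ring_scope.

(* A (not necessarily associative, not necessarily unital) algebra is a module
   together with a bilinear product. *)
Definition isomorphic_algebras (K : comNzRingType) (V W : lmodType K)
    (mu : {bilinear V -> V -> V}) (nu : {bilinear W -> W -> W}) : Prop :=
  exists f : {linear V -> W},
    bijective f /\ forall x y : V, f (mu x y) = nu (f x) (f y).

Record tleib_param (K : Type) := TLeibParam {
  c00 : K; c01 : K; c11 : K; c12 : K; c13 : K; c14 : K; c23 : K }.

Section TLeib7.
Variable K : fieldType.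
Implicit Type C : tleib_param K.

Definition e (i : nat) : 'rV[K]_7 := delta_mx 0 (inord i).

Definition basis_bracket C (i j : nat) : 'rV[K]_7 :=
  match i, j with
  | 1, 0 | 2, 0 | 3, 0 | 4, 0 | 5, 0 => e i.+1
  | 0, 2 | 0, 3 | 0, 4 | 0, 5 => - e j.+1
  | 0, 0 => c00 C *: e 6
  | 0, 1 => - e 2 + c01 C *: e 6
  | 1, 1 => c11 C *: e 6
  | 1, 2 => c12 C *: e 4 + c13 C *: e 5 + c14 C *: e 6
  | 2, 1 => - (c12 C *: e 4 + c13 C *: e 5 + c14 C *: e 6)
  | 1, 3 => c12 C *: e 5 + c13 C *: e 6
  | 3, 1 => - (c12 C *: e 5 + c13 C *: e 6)
  | 1, 4 => (c12 C - c23 C) *: e 6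
  | 4, 1 => - ((c12 C - c23 C) *: e 6)
  | 2, 3 => c23 C *: e 6
  | 3, 2 => - (c23 C *: e 6)
  | _, _ => 0
  end.

Definition bracket C (x y : 'rV[K]_7) : 'rV[K]_7 :=
  \sum_(i < 7) \sum_(j < 7) (x 0 i * y 0 j) *: basis_bracket C i j.

Lemma bracket_is_bilinear C : bilinear_for *:%R *:%R (bracket C).
Proof.
split=> u a x y /=; rewrite /bracket scaler_sumr -big_split /=;
  apply: eq_bigr => i _; rewrite scaler_sumr -big_split /=;
  apply: eq_bigr => j _; rewrite !mxE scalerA -scalerDl; congr (_ *: _).
- by rewrite mulrDl mulrA.
- by rewrite mulrDr mulrCA.
Qed.

HB.instance Definition _ C :=
  bilinear_isBilinear.Build K 'rV[K]_7 'rV[K]_7 'rV[K]_7 *:%R *:%R (bracket C)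
    (bracket_is_bilinear C).

Lemma bracket_basis C (i j : nat) : (i < 7)%N -> (j < 7)%N ->
  bracket C (e i) (e j) = basis_bracket C i j.
Proof.
move=> lti ltj; rewrite /bracket (bigD1 (inord i)) //= (bigD1 (inord j)) //=.
rewrite !mxE !eqxx mulr1 scale1r !inordK // !big1 ?addr0 //.
- move=> k /negPf nk; rewrite big1 // => l _.
  by rewrite !mxE nk andbF mul0r scale0r.
- by move=> k /negPf nk; rewrite !mxE nk !andbF mulr0 scale0r.
Qed.

Definition L C : {bilinear 'rV[K]_7 -> 'rV[K]_7 -> 'rV[K]_7} := bracket C.

Definition U7_10 : set {bilinear 'rV[K]_7 -> 'rV[K]_7 -> 'rV[K]_7} :=
  [set A | exists C, A = L C /\
    [/\ c23 C = 0, c12 C <> 0, c11 C = 0, c01 C = 0 & c00 C <> 0]].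

Definition invariant7_10 C : K :=
  (4 * c14 C * c12 C - 5 * c13 C ^+ 2) ^+ 5 / (c12 C ^+ 12 * c00 C ^+ 2).

End TLeib7.

(* Main.v *)
From HB Require Import structures.
Require Import Defs.
From mathcomp Require Import all_boot all_order all_algebra.
From mathcomp Require Import sesquilinear complex.
From mathcomp Require Import classical_sets reals.
From mathcomp Require Import ring.

(** Write a, b, c, d for the parameters c00, c12, c13, c14, the only nonzero
    ones on [U7_10], and N(lambda) for the algebra with parameters
    a = b = 1, c = 0, d = lambda.

    Everything rests on how these four constants change with the adapted basis.
    Since a is nonzero, x has square zero exactly when its e_0-coordinate
    vanishes, so any isomorphism sends e_1 to an element
    D e_1 + (terms in e_2, .., e_6), while e_0 goes to
    A e_0 + B e_1 + (terms in e_2, .., e_6).  As e_0 and e_1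
    generate the algebra, this determines the images of all e_k; in particular
    e_6 goes to D A^5 e_6, so A and D are nonzero.  Comparing coordinates
    in the products [e_0, e_0] and [e_1, e_2] then gives the new constants:
    a is divided by D A^3, b is multiplied by D / A^2, and
    4 d b - 5 c^2 is multiplied by D^2 / A^6; the number B and all the higher
    coordinates cancel out of the last quantity.  Hence
    (4 d b - 5 c^2)^5 / (b^12 a^2) is an invariant
    ([isomorphic_invariant]).

    Conversely, the elements x_0 = A e_0 + B e_1 and x_1 = D e_1 of N(lambda)
    generate a basis that multiplies by the rules of another algebra of
    [U7_10] ([frame_isomorphism]).  To obtain given constants a, b, c, d, the
    values of b and c dictate D and B, while a fixes only the fifth power of A;
    the remaining choice of a fifth root of unity is what makes d come out right
    for every lambda with (4 lambda)^5 equal to the invariant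
    ([invariant_scale], [isomorphic_normal_form]).  Two algebras with the same
    invariant are therefore isomorphic to a common N(lambda). *)

Set Implicit Arguments.
Unset Strict Implicit.
Unset Printing Implicit Defensive.

Import GRing.Theory Num.Theory.
Local Open Scope ring_scope.

(** * Isomorphism as an equivalence *)


Lemma isomorphic_algebras_sym (K : comNzRingType) (V W : lmodType K)
    (mu : {bilinear V -> V -> V}) (nu : {bilinear W -> W -> W}) :
  isomorphic_algebras mu nu -> isomorphic_algebras nu mu.
Proof.
case=> f [[g fK gK] fM].
pose gL := HB.pack_for {linear W -> V} g
  (GRing.isLinear.Build K W V *:%R g (can2_linear fK gK)).
exists gL; split; first by exists f.
by move=> x y; apply: (can_inj fK); rewrite /= fM !gK.
Qed.

Lemma isomorphic_algebras_trans (K : comNzRingType) (U V W : lmodType K)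
    (la : {bilinear U -> U -> U}) (mu : {bilinear V -> V -> V})
    (nu : {bilinear W -> W -> W}) :
  isomorphic_algebras la mu -> isomorphic_algebras mu nu ->
  isomorphic_algebras la nu.
Proof.
case=> f [f_bij fM] [g [g_bij gM]]; exists (g \o f); split; first exact: bij_comp.
by move=> x y; rewrite /= fM gM.
Qed.

(** * The bracket in coordinates *)

(** Reduces deducing one polynomial identity from another to a ring identity:
    the difference of the sides of the goal is that of the hypothesis. *)
Lemma eq_of_subr (V : zmodType) (x y u v : V) : x = y -> u - v = x - y -> u = v.
Proof. by move=> -> /eqP; rewrite subrr subr_eq0 => /eqP. Qed.

Section Coordinates.
Variable K : fieldType.
Implicit Type C : tleib_param K.

Definition row7 (x0 x1 x2 x3 x4 x5 x6 : K) : 'rV[K]_7 :=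
  \row_(i < 7) [:: x0; x1; x2; x3; x4; x5; x6]`_i.

Lemma row7E (v : 'rV[K]_7) :
  v = row7 (v 0 (inord 0)) (v 0 (inord 1)) (v 0 (inord 2)) (v 0 (inord 3))
           (v 0 (inord 4)) (v 0 (inord 5)) (v 0 (inord 6)).
Proof.
apply/rowP => i; rewrite mxE.
by case: i => [] [|[|[|[|[|[|[|//]]]]]]] lti /=; congr (v 0 _);
  apply: val_inj; rewrite /= inordK.
Qed.

Lemma row7_inj x0 x1 x2 x3 x4 x5 x6 y0 y1 y2 y3 y4 y5 y6 :
  row7 x0 x1 x2 x3 x4 x5 x6 = row7 y0 y1 y2 y3 y4 y5 y6 ->
  [/\ x0 = y0, x1 = y1, x2 = y2 & x3 = y3] /\ [/\ x4 = y4, x5 = y5 & x6 = y6].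
Proof.
move=> /rowP xy; do !split.
- by have := xy (inord 0); rewrite !mxE inordK.
- by have := xy (inord 1); rewrite !mxE inordK.
- by have := xy (inord 2); rewrite !mxE inordK.
- by have := xy (inord 3); rewrite !mxE inordK.
- by have := xy (inord 4); rewrite !mxE inordK.
- by have := xy (inord 5); rewrite !mxE inordK.
- by have := xy (inord 6); rewrite !mxE inordK.
Qed.

Lemma row7D x0 x1 x2 x3 x4 x5 x6 y0 y1 y2 y3 y4 y5 y6 :
  row7 x0 x1 x2 x3 x4 x5 x6 + row7 y0 y1 y2 y3 y4 y5 y6 =
  row7 (x0 + y0) (x1 + y1) (x2 + y2) (x3 + y3) (x4 + y4) (x5 + y5) (x6 + y6).
Proof.
by apply/rowP => i; rewrite !mxE; case: i => [] [|[|[|[|[|[|[|//]]]]]]].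
Qed.

Lemma row7Z a x0 x1 x2 x3 x4 x5 x6 :
  a *: row7 x0 x1 x2 x3 x4 x5 x6 =
  row7 (a * x0) (a * x1) (a * x2) (a * x3) (a * x4) (a * x5) (a * x6).
Proof.
by apply/rowP => i; rewrite !mxE; case: i => [] [|[|[|[|[|[|[|//]]]]]]].
Qed.

Lemma row7N x0 x1 x2 x3 x4 x5 x6 :
  - row7 x0 x1 x2 x3 x4 x5 x6 =
  row7 (- x0) (- x1) (- x2) (- x3) (- x4) (- x5) (- x6).
Proof.
by apply/rowP => i; rewrite !mxE; case: i => [] [|[|[|[|[|[|[|//]]]]]]].
Qed.

Lemma e_row7 (i : nat) : (i < 7)%N ->
  e K i = row7 (i == 0)%:R (i == 1)%:R (i == 2)%:R (i == 3)%:R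
               (i == 4)%:R (i == 5)%:R (i == 6)%:R.
Proof.
move=> lti; apply/rowP => j; rewrite !mxE eqxx /= -val_eqE /= inordK //.
by rewrite eq_sym; case: j => [] [|[|[|[|[|[|[|//]]]]]]].
Qed.

Lemma row70 : 0 = row7 0 0 0 0 0 0 0.
Proof.
by apply/rowP => i; rewrite !mxE; case: i => [] [|[|[|[|[|[|[|//]]]]]]].
Qed.

Lemma bracket_row7 C x0 x1 x2 x3 x4 x5 x6 y0 y1 y2 y3 y4 y5 y6 :
  bracket C (row7 x0 x1 x2 x3 x4 x5 x6) (row7 y0 y1 y2 y3 y4 y5 y6) =
  row7 0 0
    (x1 * y0 - x0 * y1)
    (x2 * y0 - x0 * y2)
    (x3 * y0 - x0 * y3 + c12 C * (x1 * y2 - x2 * y1))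
    (x4 * y0 - x0 * y4 + c13 C * (x1 * y2 - x2 * y1)
     + c12 C * (x1 * y3 - x3 * y1))
    (x5 * y0 - x0 * y5 + c14 C * (x1 * y2 - x2 * y1)
     + c13 C * (x1 * y3 - x3 * y1) + (c12 C - c23 C) * (x1 * y4 - x4 * y1)
     + c23 C * (x2 * y3 - x3 * y2)
     + c00 C * (x0 * y0) + c01 C * (x0 * y1) + c11 C * (x1 * y1)).
Proof.
rewrite /bracket !big_ord_recl !big_ord0 /=.
rewrite !mxE /= !e_row7 //= row70 !(row7N, row7Z, row7D).
congr (row7 _ _ _ _ _ _ _); ring.
Qed.

(** Membership in [U7_10] is existential over the parameters; injectivity turns
    it into conditions on the given ones. *)
Lemma L_inj C C' : L C = L C' -> C = C'.
Proof.
move=> eqL.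
have eqb x y : bracket C x y = bracket C' x y.
  by rewrite -[bracket C]/(L C : _ -> _ -> _) eqL.
have := (eqb (e K 0) (e K 0), eqb (e K 0) (e K 1), eqb (e K 1) (e K 1)).
rewrite !e_row7 //= !bracket_row7 /= !(mulr0, mul0r, mulr1, add0r, addr0, subr0, oppr0).
move=> [] [] /row7_inj[_ [_ _ h00]] /row7_inj[_ [_ _ h01]] /row7_inj[_ [_ _ h11]].
have := (eqb (e K 1) (e K 2), eqb (e K 2) (e K 3)).
rewrite !e_row7 //= !bracket_row7 /= !(mulr0, mul0r, mulr1, add0r, addr0, subr0, oppr0).
move=> [] /row7_inj[_ [h12 h13 h14]] /row7_inj[_ [_ _ h23]].
by case: C C' h00 h01 h11 h12 h13 h14 h23 {eqL eqb} =>
  ? ? ? ? ? ? ? [? ? ? ? ? ? ?] /= -> -> -> -> -> -> ->.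
Qed.

Lemma U7_10_L C : U7_10 (L C) ->
  [/\ c23 C = 0, c12 C != 0, c11 C = 0, c01 C = 0 & c00 C != 0].
Proof. by case=> C0 [/L_inj -> [? /eqP ? ? ? /eqP ?]]. Qed.

(** When c23 = 0 the elements e 2, .., e 6 annihilate one another, so right
    multiplication on their span sees only two coordinates of the multiplier. *)
Lemma bracket_row7_derived C y2 y3 y4 y5 y6 p0 p1 p2 p3 p4 p5 p6 :
  c23 C = 0 ->
  bracket C (row7 0 0 y2 y3 y4 y5 y6) (row7 p0 p1 p2 p3 p4 p5 p6) =
  row7 0 0 0 (y2 * p0) (y3 * p0 - c12 C * y2 * p1)
    (y4 * p0 - c13 C * y2 * p1 - c12 C * y3 * p1)
    (y5 * p0 - c14 C * y2 * p1 - c13 C * y3 * p1 - c12 C * y4 * p1).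
Proof. by move=> c23_0; rewrite bracket_row7 c23_0; congr row7; ring. Qed.

(** * Invariance *)

(** With the images of e 0 and e 1 written p and q, the images of e 2, .., e 6
    are iterated brackets with p, and the image of e 6 is q1 p0^5 e 6; so p0 and
    q1 are nonzero, and [e_0, e_0] and [e_1, e_2] express the constants of C' in
    those of C. *)
Lemma isomorphic_invariant C C' : U7_10 (L C) -> U7_10 (L C') ->
  isomorphic_algebras (L C) (L C') -> invariant7_10 C' = invariant7_10 C.
Proof.
move=> /U7_10_L[d0 b_neq0 h11 _ a_neq0] /U7_10_L[d0' b_neq0' h11' h01' a_neq0'].
case=> f [f_bij fM'].
have fM i j : (i < 7)%N -> (j < 7)%N ->
    f (basis_bracket C i j) = bracket C' (f (e K i)) (f (e K j)).
  by move=> lti ltj; rewrite -bracket_basis //; apply: fM'.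
have := fM 1%N 1%N isT isT; have := fM 0%N 0%N isT isT.
have := fM 1%N 2%N isT isT; have := fM 5%N 0%N isT isT.
have := fM 4%N 0%N isT isT; have := fM 3%N 0%N isT isT.
have := fM 2%N 0%N isT isT; have := fM 1%N 0%N isT isT; rewrite /=.
have f6_neq0 : f (e K 6) != 0.
  rewrite -(raddf0 f) (inj_eq (bij_inj f_bij)).
  apply/eqP => /rowP/(_ (inord 6)); rewrite !mxE !eqxx /=.
  by apply/eqP; rewrite oner_eq0.
rewrite (row7E (f (e K 0))) (row7E (f (e K 1))).
move: (f (e K 0) 0 _) (f (e K 0) 0 _) (f (e K 0) 0 _) (f (e K 0) 0 _)
  (f (e K 0) 0 _) (f (e K 0) 0 _) (f (e K 0) 0 _) => p6 p5 p4 p3 p2 p1 p0.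
move: (f (e K 1) 0 _) (f (e K 1) 0 _) (f (e K 1) 0 _) (f (e K 1) 0 _)
  (f (e K 1) 0 _) (f (e K 1) 0 _) (f (e K 1) 0 _) => q6 q5 q4 q3 q2 q1 q0.
move=> f2 f3 f4 f5 f6 f12 f00 f11.
(* [e_1, e_1] = 0 in the source, and squares are c00 C' times q0 ^+ 2. *)
have q00 : q0 = 0.
  move: f11; rewrite h11 scale0r raddf0 row70 bracket_row7 h11' h01' d0'.
  case/row7_inj => _ [_ _ sq0]; have /eqP : c00 C' * (q0 * q0) = 0.
    by rewrite sq0; ring.
  by rewrite !mulf_eq0 orbb (negPf a_neq0') => /eqP.
rewrite {}q00 in f2 f12 *.
have {}f2 : exists y4 y5 y6, f (e K 2) = row7 0 0 (q1 * p0) (q2 * p0) y4 y5 y6.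
  by rewrite f2 bracket_row7 !(mul0r, subr0); do 3!eexists.
case: f2 => y4 [y5 [y6 f2]].
rewrite f2 bracket_row7_derived // in f3.
(* Folded to keep the coordinates of the next images small. *)
set y35 := _ - _ - _ in f3.
rewrite f3 bracket_row7_derived // in f4.
rewrite f4 bracket_row7_derived // in f5.
rewrite f5 bracket_row7_derived // in f6.
have {}f6 : f (e K 6) = row7 0 0 0 0 0 0 (q1 * p0 ^+ 5).
  by rewrite f6; congr row7; ring.
have [p0_neq0 q1_neq0] : p0 != 0 /\ q1 != 0.
  split; apply: contraNneq f6_neq0 => z; rewrite f6 z row70;
  by apply/eqP; congr row7; ring.
rewrite !linearD !linearZ /= f2 f4 f5 f6 !bracket_row7 !row7Z !row7D in f00 f12.
rewrite h11' h01' d0' in f00 f12.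
have [_ [_ _ eq_a]] := row7_inj f00.
have [_ [eq_b eq_c eq_d]] := row7_inj f12.
rewrite /invariant7_10.
move: (c00 C) (c12 C) (c13 C) (c14 C) (c00 C') (c12 C') (c13 C') (c14 C')
  a_neq0 b_neq0 @y35 eq_a eq_b eq_c eq_d
  {f6_neq0 f11 f00 f12 f2 f3 f4 f5 f6 fM b_neq0' a_neq0'}.
move=> a b c d a' b' c' d' a_neq0 b_neq0 y35 eq_a eq_b eq_c eq_d.
(* eq_b, eq_c, eq_d are the coordinates 4, 5, 6 of the image of
   [e_1, e_2] = b e_4 + c e_5 + d e_6.  They are triangular in b', c', d'. *)
have -> : a' = a * q1 * p0 ^+ 3.
  apply: (mulIf (expf_neq0 2 p0_neq0)); apply: (eq_of_subr (esym eq_a)); ring.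
have b'E : b' = b * p0 ^+ 2 / q1.
  apply: (canRL (mulfK q1_neq0)); apply: (mulIf (mulf_neq0 q1_neq0 p0_neq0)).
  apply: (eq_of_subr (esym eq_b)); ring.
have c'E : c' = (c * p0 ^+ 3 - 2 * b * b' * p0 * p1) / q1.
  apply: (canRL (mulfK q1_neq0)); apply: (mulIf (mulf_neq0 q1_neq0 p0_neq0)).
  by apply: (eq_of_subr (esym eq_c)); rewrite b'E; field.
have -> : d' = (d * p0 ^+ 4 - 2 * b * c' * p0 * p1 + b * b' ^+ 2 * p1 ^+ 2
                - 3 * b' * c * p0 ^+ 2 * p1) / q1.
  apply: (canRL (mulfK q1_neq0)); apply: (mulIf (mulf_neq0 q1_neq0 p0_neq0)).
  by apply: (eq_of_subr (esym eq_d)); rewrite /y35 c'E b'E; field.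
by rewrite c'E b'E; field; rewrite a_neq0 b_neq0 p0_neq0 q1_neq0.
Qed.

End Coordinates.

(** * Reduction to the normal form *)

Local Notation normal_form lambda := (L (TLeibParam 1 0 0 1 0 lambda 0)).

(** The isomorphism sends e 0 and e 1 to x_0 = A e_0 + B e_1 and x_1 = D e_1,
    hence e k.+1 to the iterated right multiple of x_1 by x_0. *)
Lemma frame_isomorphism (K : fieldType) (A B D lambda : K) : A != 0 -> D != 0 ->
  isomorphic_algebras
    (L (TLeibParam (D * A ^+ 3)^-1 0 0 (D / A ^+ 2) (2 * B * D / A ^+ 4)
          (D * (lambda + 5 * B ^+ 2 / A ^+ 2) / A ^+ 4) 0))
    (normal_form lambda).
Proof.
move=> A_neq0 D_neq0.
pose f (v : 'rV[K]_7) : 'rV[K]_7 := let u k := v 0 (inord k) in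
  row7 (A * u 0%N) (B * u 0%N + D * u 1%N) (D * A * u 2%N) (D * A ^+ 2 * u 3%N)
    (D * A ^+ 3 * u 4%N - D * A * B * u 3%N)
    (D * A ^+ 4 * u 5%N - 2 * D * A ^+ 2 * B * u 4%N)
    (D * A ^+ 5 * u 6%N - D * A * B * lambda * u 3%N + D * A * B ^+ 2 * u 4%N
     - 3 * D * A ^+ 3 * B * u 5%N).
(* The system f u = v is triangular; g is its back substitution. *)
pose g (w : 'rV[K]_7) : 'rV[K]_7 := let v k := w 0 (inord k) in
  let u3 := v 3%N / (D * A ^+ 2) in
  let u4 := (v 4%N + D * A * B * u3) / (D * A ^+ 3) in
  let u5 := (v 5%N + 2 * D * A ^+ 2 * B * u4) / (D * A ^+ 4) in
  row7 (v 0%N / A) ((v 1%N - B * (v 0%N / A)) / D) (v 2%N / (D * A)) u3 u4 u5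
    ((v 6%N + D * A * B * lambda * u3 - D * A * B ^+ 2 * u4
      + 3 * D * A ^+ 3 * B * u5) / (D * A ^+ 5)).
have f_linear : linear f.
  by move=> k u v; rewrite /f row7Z row7D !mxE; congr row7; ring.
pose fL := HB.pack_for {linear 'rV[K]_7 -> 'rV[K]_7} f
  (GRing.isLinear.Build K 'rV[K]_7 'rV[K]_7 *:%R f f_linear).
exists fL; split.
  exists g => v; rewrite (row7E v) /= /f /g !mxE !inordK //=;
    by congr row7; field; rewrite ?A_neq0 ?D_neq0.
move=> x y; rewrite (row7E x) (row7E y) /=.
rewrite -![L _ _ _]/(bracket _ _ _) bracket_row7 /f !mxE !inordK //= bracket_row7 /=.
by congr row7; field; rewrite ?A_neq0 ?D_neq0.
Qed.

Section ClosedField.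
Variable K : numClosedFieldType.

(** Here q stands for 4 d b - 5 c^2.  The two equations on A are what matching
    the constants a and d of the frame with those of the normal form requires;
    the hypothesis is the compatibility condition obtained by eliminating A. *)
Lemma invariant_scale (a b q lambda : K) : a != 0 -> b != 0 ->
  q ^+ 5 / (b ^+ 12 * a ^+ 2) = (4 * lambda) ^+ 5 ->
  exists A : K, a * b * A ^+ 5 = 1 /\ q * A ^+ 2 = 4 * b ^+ 2 * lambda.
Proof.
move=> a_neq0 b_neq0 eq_inv.
have den_neq0 : b ^+ 12 * a ^+ 2 != 0 by rewrite mulf_neq0 ?expf_neq0.
have {eq_inv} eq_q : q ^+ 5 = (4 * lambda) ^+ 5 * (b ^+ 12 * a ^+ 2).
  by rewrite -eq_inv divfK.
have [q0|q_neq0] := eqVneq q 0.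
  exists (5.-root (a * b)^-1); rewrite rootCK // divff ?mulf_neq0 // q0 mul0r.
  split=> //; move: eq_q; rewrite q0 expr0n => /esym /eqP.
  rewrite mulf_eq0 (negPf den_neq0) orbF expf_eq0 mulf_eq0 pnatr_eq0 /= => /eqP->.
  by rewrite mulr0.
(* A = (A^2)^3 / A^5, where both powers are prescribed. *)
exists ((4 * b ^+ 2 * lambda / q) ^+ 3 * (a * b)).
pose ratio := (4 * lambda) ^+ 5 * (b ^+ 12 * a ^+ 2) / q ^+ 5.
have ratio1 : ratio = 1 by rewrite /ratio -eq_q divff ?expf_neq0.
split.
  by transitivity (ratio ^+ 3); [rewrite /ratio; field | rewrite ratio1 expr1n].
transitivity (4 * b ^+ 2 * lambda * ratio); last by rewrite ratio1 mulr1.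
by rewrite /ratio; field.
Qed.

Lemma isomorphic_normal_form (C : tleib_param K) (lambda : K) : U7_10 (L C) ->
  invariant7_10 C = (4 * lambda) ^+ 5 ->
  isomorphic_algebras (L C) (normal_form lambda).
Proof.
move=> /U7_10_L; case: C => a c01 c11 b c d c23 /= [-> b_neq0 -> -> a_neq0].
rewrite /invariant7_10 /= => /invariant_scale[] // A [A5 A2].
have A_neq0 : A != 0.
  by apply: contra_eq_neq A5 => ->; rewrite expr0n mulr0 eq_sym oner_eq0.
have -> : TLeibParam a 0 0 b c d 0 =
    (* D and B are forced by the values b and c of D / A^2 and 2 B D / A^4. *)
    let D := b * A ^+ 2 in let B := c * A ^+ 2 / (2 * b) in
    TLeibParam (D * A ^+ 3)^-1 0 0 (D / A ^+ 2) (2 * B * D / A ^+ 4)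
      (D * (lambda + 5 * B ^+ 2 / A ^+ 2) / A ^+ 4) 0.
  move=> /=; congr TLeibParam.
  - rewrite -[RHS]mul1r; apply: canRL (mulfK _) _.
      by rewrite !mulf_neq0 ?expf_neq0.
    by rewrite -A5; ring.
  - by field; rewrite A_neq0.
  - by field; rewrite A_neq0 b_neq0.
  - have -> : lambda = (4 * d * b - 5 * c ^+ 2) * A ^+ 2 / (4 * b ^+ 2).
      by rewrite A2; field; rewrite b_neq0.
    by field; rewrite A_neq0 b_neq0.
by apply: frame_isomorphism; rewrite ?mulf_neq0 ?expf_neq0.
Qed.

Lemma normal_invariant_surj (y : K) : exists lambda : K, y = (4 * lambda) ^+ 5.
Proof.
exists (5.-root y / 4); rewrite mulrC divfK ?rootCK //.
by rewrite pnatr_eq0.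
Qed.

Lemma U7_10_normal_form (lambda : K) : U7_10 (normal_form lambda).
Proof.
exists (TLeibParam 1 0 0 1 0 lambda 0); split=> //.
by split=> //; apply/eqP; rewrite oner_eq0.
Qed.

End ClosedField.

Theorem proposition2p8 (R : realType) :
  (forall C C' : tleib_param R[i],
     U7_10 (L C) -> U7_10 (L C') ->
     (isomorphic_algebras (L C) (L C') <->
      invariant7_10 C' = invariant7_10 C)) /\
  (forall lambda : R[i],
     exists C : tleib_param R[i], U7_10 (L C) /\ invariant7_10 C = lambda) /\
  ((forall lambda : R[i], U7_10 (L (TLeibParam 1 0 0 1 0 lambda 0))) /\
   (forall A : {bilinear 'rV[R[i]]_7 -> 'rV[R[i]]_7 -> 'rV[R[i]]_7},
      U7_10 A ->
      exists lambda : R[i],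
        isomorphic_algebras A (L (TLeibParam 1 0 0 1 0 lambda 0)))).
Proof.
split=> [C C' UC UC'|].
  split=> [|eq_inv]; first exact: isomorphic_invariant.
  have [lambda inv_lambda] := normal_invariant_surj (invariant7_10 C).
  apply: isomorphic_algebras_trans (isomorphic_normal_form UC inv_lambda) _.
  apply: isomorphic_algebras_sym; apply: isomorphic_normal_form => //.
  by rewrite eq_inv.
split=> [y|].
  have [lambda ->] := normal_invariant_surj y.
  exists (TLeibParam 1 0 0 1 0 lambda 0); split; first exact: U7_10_normal_form.
  by rewrite /invariant7_10 /=; field.
split=> [lambda|A UA]; first exact: U7_10_normal_form.
case: (UA) => C [AE _]; rewrite {}AE in UA *.
have [lambda inv_lambda] := normal_invariant_surj (invariant7_10 C).
by exists lambda; apply: isomorphic_normal_form.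
Qed.
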